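(* Let $h(\cdot,\theta)=[h_1(\cdot,\theta),\dots,h_q(\cdot,\theta)]^T:\mathbb{R}^p\to\mathbb{R}^q$ be twice continuously differentiable in $x$ (for a fixed parameter $\theta$). For each $r\in\{1,\dots,q\}$ let $$s_r:=\sup_{x\in\mathbb{R}^p}\|\nabla^2_x h_r(x,\theta)\|_2,$$ and assume $0<s_r<\infty$. Fix $0<c<1$ and define $$\mathcal{S}_r:=\{x\in\mathbb{R}^p:\ \|\nabla^2_x h_r(x,\theta)\|_2>c\cdot s_r\},\qquad r\in\{1,\dots,q\}.$$ Suppose that $\mu\left(\bigcup_{r=1}^q\mathcal{S}_r\right)<C$ for some finite constant $C$, where $\mu$ is Lebesgue measure on $\mathbb{R}^p$. Then for every $\epsilon>0$ there exists a probability distribution $\mathcal{P}$ on $\mathbb{R}^p$ such that $$\sup_{x\in\mathbb{R}^p}\left\|\mathbb{E}_{\eta\sim\mathcal{P}}\,\nabla^2_x h_r(x+\eta,\theta)\right\|_2<(c+\epsilon)\cdot s_r\qquad\text{for all } r\in\{1,\dots,q\}.$$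
   Context: $h$ represents a single neural network layer with parameters $\theta$; $\nabla^2_x h_r(x,\theta)\in\mathbb{R}^{p\times p}$ is the Hessian of the $r$-th output coordinate with respect to the input $x$, and $\|\cdot\|_2$ on matrices is the spectral (operator) norm. The expectation of the Hessian is taken entrywise over a random perturbation $\eta$ of the input drawn from $\mathcal{P}$. *)

(* Defs.v *)
From HB Require Import structures.
From mathcomp Require Import all_boot all_order all_algebra.
From mathcomp Require Import all_classical all_reals all_analysis.
Set Implicit Arguments. Unset Strict Implicit. Unset Printing Implicit Defensive.
Import Order.TTheory GRing.Theory Num.Theory.
Import numFieldNormedType.Exports.
Local Open Scope classical_set_scope.
Local Open Scope ring_scope.

Section Defs.
Variable R : realType.

(* points of R^p are row vectors 'rV[R]_p (for calculus); the measurable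
   space R^p is p.-tuple R with its product (= Borel) sigma-algebra;
   tvec identifies the two. *)
Definition tvec (p : nat) (t : p.-tuple R) : 'rV[R]_p := \row_(i < p) tnth t i.

Definition ebasis (p : nat) (i : 'I_p) : 'rV[R]_p := delta_mx 0 i.

Definition C2 (p : nat) (f : 'rV[R]_p -> R) : Prop :=
  (forall j x, derivable f x (ebasis j)) /\
  (forall i j x, derivable ('D_(ebasis j) f) x (ebasis i)) /\
  (forall j, continuous ('D_(ebasis j) f)) /\
  (forall i j, continuous ('D_(ebasis i) ('D_(ebasis j) f))).

Definition hessian (p : nat) (f : 'rV[R]_p -> R) (x : 'rV[R]_p) : 'M[R]_p :=
  \matrix_(i < p, j < p) 'D_(ebasis i) ('D_(ebasis j) f) x.

Definition l2norm (p : nat) (v : 'cV[R]_p) : R := Num.sqrt (\sum_(i < p) v i 0 ^+ 2).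

Definition spec_norm (p : nat) (M : 'M[R]_p) : R :=
  sup [set l2norm (M *m u) | u in [set u : 'cV[R]_p | l2norm u = 1]].

(* p-dimensional Lebesgue integral of a nonnegative function, as the iterated
   one-dimensional Lebesgue integral (Tonelli), and Lebesgue measure of a set *)
Fixpoint leb_iter (p : nat) : (p.-tuple R -> \bar R) -> \bar R :=
  match p with
  | 0 => fun f => f [tuple]
  | p'.+1 => fun f =>
      (\int[@lebesgue_measure R]_t leb_iter (fun y : p'.-tuple R => f [tuple of t :: y]))%E
  end.

Definition lebesgue_p (p : nat) (A : set 'rV[R]_p) : \bar R :=
  leb_iter (fun t : p.-tuple R => (\1_(@tvec p @^-1` A) t)%:E).

End Defs.

(* Main.v *)
Require Import Defs.
From HB Require Import structures.
From mathcomp Require Import all_boot all_order all_algebra.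
From mathcomp Require Import all_classical all_reals all_analysis.
From mathcomp Require Import measurable_realfun ring lra.
Set Implicit Arguments. Unset Strict Implicit. Unset Printing Implicit Defensive.
Import Order.TTheory GRing.Theory Num.Theory.
Import numFieldNormedType.Exports.
Local Open Scope classical_set_scope.
Local Open Scope ring_scope.

(* Take for P the uniform distribution on a cube of volume K^-p, for a small K:
   every translate of P has density at most K^p, so x + eta falls in the union U
   of the S_r with probability at most K^p mu(U), uniformly in x.  Outside U the
   Hessian of h_r has norm at most c s_r, and on U at most s_r; averaging gives
   |E H_r(x + eta)| <= c s_r + s_r K^p mu(U). *)

(** * Iterated Lebesgue integrals on tuples *)

Lemma leb_iter_ge0 (R : realType) n (f : n.-tuple R -> \bar R) :
  (forall y, 0 <= f y)%E -> (0 <= leb_iter f)%E.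
Proof.
elim: n f => [|n IH] f f0 /=; first exact: f0.
by apply: integral_ge0 => t _; exact: IH.
Qed.

(** The parameter space [T] is arbitrary so that the induction closes: each step moves the outermost
    integration variable into the parameters, replacing [T] by [T * R], and Tonelli then gives
    measurability of the integral over that variable. *)
Lemma measurable_leb_iter (R : realType) d (T : measurableType d) n
    (f : T * n.-tuple R -> \bar R) :
  measurable_fun [set: T * n.-tuple R] f -> (forall z, 0 <= f z)%E ->
  measurable_fun [set: T] (fun x => leb_iter (fun y => f (x, y))).
Proof.
elim: n d T f => [|n IH] d T f mf f0 /=.
  by apply: (measurableT_comp mf); exact: measurable_fun_pair.
apply: (measurable_fun_fubini_tonelli_F
  (m2 := @lebesgue_measure R) (fun z : T * measurableTypeR R =>
    leb_iter (fun y : n.-tuple R => f (z.1, [tuple of z.2 :: y])))) => /=; last first.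
  by move=> z; apply: leb_iter_ge0 => y; exact: f0.
apply: (IH _ (T * measurableTypeR R)%type
  (fun w : (T * measurableTypeR R) * n.-tuple R =>
     f (w.1.1, [tuple of w.1.2 :: w.2]))) => //.
apply: (measurableT_comp mf); apply: measurable_fun_pair => /=.
  exact: measurableT_comp.
by apply: measurable_cons => //; exact: measurableT_comp.
Qed.

(** * Product probabilities on tuples and domination of their translates *)

Definition cons_pair (R : realType) n (z : measurableTypeR R * n.-tuple R) :
  n.+1.-tuple R := [tuple of z.1 :: z.2].

Lemma measurable_cons_pair (R : realType) n :
  measurable_fun [set: measurableTypeR R * n.-tuple R] (@cons_pair R n).
Proof. exact: measurable_cons. Qed.

HB.instance Definition _ (R : realType) n :=
  isMeasurableFun.Build _ _ _ _ (@cons_pair R n) (@measurable_cons_pair R n).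

(** The n-fold product of [Q]. The recursion on the first coordinate mirrors that of [leb_iter], so
    that the two integrals can be compared by induction on the length. *)
Fixpoint tuple_prob (R : realType) (Q : probability (measurableTypeR R) R) n :
    probability (n.-tuple R) R :=
  match n with
  | 0 => dirac ([tuple] : 0.-tuple R)
  | n'.+1 => distribution (Q \x tuple_prob Q n')%E (@cons_pair R n')
  end.

Definition tuple_add (R : realType) n (x y : n.-tuple R) : n.-tuple R :=
  [tuple tnth x i + tnth y i | i < n].

Lemma tuple_add_cons (R : realType) n (x : n.+1.-tuple R) t (y : n.-tuple R) :
  tuple_add x [tuple of t :: y] =
  [tuple of (thead x + t) :: tuple_add [tuple of behead x] y].
Proof.
apply: eq_from_tnth => i; case: (unliftP ord0 i) => [j|] ->.
  rewrite tnth_mktuple !tnthS tnth_mktuple; congr (_ + _).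
  by rewrite [in LHS](tuple_eta x) tnthS.
by rewrite tnth_mktuple !tnth0.
Qed.

Lemma measurable_tuple_add (R : realType) n (x : n.-tuple R) :
  measurable_fun [set: n.-tuple R] (tuple_add x).
Proof.
apply/measurable_fun_tnthP => i.
rewrite (_ : _ \o _ = fun y => tnth x i + tnth y i); last first.
  by apply/funext => y /=; rewrite tnth_mktuple.
by apply: measurable_funD => //; exact: measurable_tnth.
Qed.

(** Setwise form of: every translate of [Q] has Lebesgue density at most [K]. *)
Definition translates_le (R : realType)
    (Q : probability (measurableTypeR R) R) (K : R) :=
  forall (a : R) (A : set (measurableTypeR R)), measurable A ->
    (Q ((fun t => a + t)%R @^-1` A) <= K%:E * lebesgue_measure A)%E.

(** The left side is an integral against the law of [a + t], which is dominated setwise by [K] times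
    Lebesgue measure; domination of measures passes to integrals of nonnegative functions. *)
Lemma integral_shift_le (R : realType)
    (Q : probability (measurableTypeR R) R) (K a : R)
    (g : measurableTypeR R -> \bar R) : 0 <= K ->
  translates_le Q K ->
  measurable_fun setT g -> (forall t, 0 <= g t)%E ->
  (\int[Q]_t g (a + t)%R <= K%:E * \int[@lebesgue_measure R]_t g t)%E.
Proof.
move=> K0 QK mg g0.
have ma : measurable_fun [set: measurableTypeR R]
    ((fun t => a + t) : measurableTypeR R -> measurableTypeR R).
  by apply: measurable_funD => //.
have -> : (\int[Q]_t g (a + t)%R = \int[pushforward Q
    ((fun t => a + t)%R : measurableTypeR R -> measurableTypeR R)]_t g t)%E.
  by rewrite ge0_integral_pushforward.
rewrite -(ge0_integral_mscale _ measurableT (NngNum K0)) //.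
by apply: ge0_le_measure_integral => // A mA; exact: QK.
Qed.

(** Each coordinate costs one factor [K]: Tonelli isolates the first coordinate, induction bounds
    the inner integral by [K ^+ n], and [integral_shift_le] handles the outer one. *)
Lemma tuple_prob_shift_le (R : realType)
    (Q : probability (measurableTypeR R) R) (K : R) n
    (x : n.-tuple R) (f : n.-tuple R -> \bar R) : 0 <= K ->
  translates_le Q K ->
  measurable_fun setT f -> (forall y, 0 <= f y)%E ->
  (\int[tuple_prob Q n]_y f (tuple_add x y) <= (K ^+ n)%:E * leb_iter f)%E.
Proof.
move=> K0 QK; elim: n x f => [|n IH] x f mf f0 /=.
  rewrite integral_dirac//; last first.
    by apply: (measurableT_comp mf); exact: measurable_tuple_add.
  by rewrite diracT !mul1e (tuple0 (tuple_add _ _)).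
have mfx : measurable_fun setT (fun y => f (tuple_add x y)).
  by apply: (measurableT_comp mf); exact: measurable_tuple_add.
rewrite ge0_integral_pushforward//.
set h := _ \o _.
have mh : measurable_fun setT h by apply: (measurableT_comp mfx).
have h0 z : (0 <= h z)%E by exact: f0.
rewrite fubini_tonelli1//=.
rewrite /fubini_F.
pose g (t : measurableTypeR R) :=
  leb_iter (fun y : n.-tuple R => f [tuple of t :: y]).
have mg : measurable_fun setT g.
  apply: (@measurable_leb_iter R _ (measurableTypeR R) n
    (fun z => f (cons_pair z))) => //; exact: (measurableT_comp mf).
have g0 t : (0 <= g t)%E by apply: leb_iter_ge0 => y; exact: f0.
(* Inner bound: once [t] is fixed, the translated tuple has head [thead x + t], and the induction
   hypothesis applies to its tail. *)
apply: (@le_trans _ _ (\int[Q]_t ((K ^+ n)%:E * g (thead x + t)%R))%E).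
  apply: ge0_le_integral => //.
  - by move=> t _; apply: integral_ge0 => y _; exact: f0.
  - exact: (measurable_fun_fubini_tonelli_F (m2 := tuple_prob Q n) h).
  - by apply: emeasurable_funM => //; apply: (measurableT_comp mg);
      exact: measurable_funD.
  - move=> t _; rewrite /h /=.
    under eq_integral do rewrite /cons_pair tuple_add_cons.
    apply: (IH _ (fun y => f [tuple of (thead x + t) :: y])) => //.
    by apply: (measurableT_comp mf); exact: measurable_cons.
rewrite ge0_integralZl ?lee_fin ?exprn_ge0//; last first.
  by apply: (measurableT_comp mg); exact: measurable_funD.
rewrite exprSr EFinM -muleA lee_wpmul2l ?lee_fin ?exprn_ge0//.
exact: integral_shift_le.
Qed.

(** * Translation invariance and the uniform law on an interval *)

(** By uniqueness of Lebesgue measure it is enough that the pushforward under the shift gives each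
    interval []b, c]] its length. *)
Lemma lebesgue_measure_shift (R : realType) (a : R)
    (A : set (measurableTypeR R)) :
  measurable A ->
  lebesgue_measure ((fun t => a + t) @^-1` A) = lebesgue_measure A.
Proof.
move=> mA.
have ma : measurable_fun [set: measurableTypeR R]
    ((fun t => a + t) : measurableTypeR R -> measurableTypeR R).
  by apply: measurable_funD => //.
pose f : {mfun measurableTypeR R >-> measurableTypeR R} :=
  HB.pack (fun t => a + t : measurableTypeR R)
    (isMeasurableFun.Build _ _ _ _ _ ma).
apply/esym.
apply: (lebesgue_measure_unique (mu := pushforward lebesgue_measure f)) => //.
move=> _ [[b c] _ <-] /=; rewrite /pushforward /=.
have -> : (fun t => a + t) @^-1` `]b, c] = `]b - a, c - a]%classic.
  apply/seteqP; split=> t /=; rewrite !in_itv/= => /andP[h1 h2];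
    apply/andP; split; lra.
rewrite !lebesgue_measure_itv/= !lte_fin ltrD2r; case: ifP => // _.
by rewrite -!EFinB; congr (_%:E); ring.
Qed.

(** The uniform density on an interval of length [l] is at most [l^-1], and translation invariance
    absorbs the shift on the Lebesgue side. *)
Lemma uniform_prob_shift_le (R : realType) (l a : R) (l0 : 0 < l)
    (A : set (measurableTypeR R)) : measurable A ->
  (uniform_prob l0 ((fun t => a + t)%R @^-1` A) <=
   (l^-1)%:E * lebesgue_measure A)%E.
Proof.
move=> mA.
have mB : measurable ((fun t => a + t) @^-1` A : set (measurableTypeR R)).
  rewrite -[X in measurable X]setTI.
  by apply: (measurable_funD (f := cst a) (g := id)).
rewrite -(lebesgue_measure_shift a mA) /uniform_prob.
rewrite -(integral_cst _ mB); apply: ge0_le_integral => //.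
- by move=> x _; rewrite lee_fin uniform_pdf_ge0.
- apply: measurable_funTS; apply: measurableT_comp => //.
  exact: measurable_uniform_pdf.
- move=> x _; rewrite lee_fin /uniform_pdf subr0; case: ifP => // _.
  by rewrite invr_ge0 ltW.
Qed.

(** * Borel sets of row vectors seen through [tvec] *)

(** An open set is the union of the countably many cubes inside it that have a rational centre and
    radius [1/(k+1)]; each cube is a finite intersection of coordinate conditions, hence
    measurable. *)
Lemma measurable_tvec_open (R : realType) n (U : set 'rV[R]_n) :
  open U -> measurable (@tvec R n @^-1` U).
Proof.
move=> oU.
pose box (ck : 'rV[rat]_n * nat) : set (n.-tuple R) :=
  [set t | forall i, `|ratr (ck.1 0 i) - tnth t i| < ck.2.+1%:R^-1].
pose good := [set ck | box ck `<=` @tvec R n @^-1` U].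
have mbox ck : measurable (box ck).
  rewrite (_ : box ck = \bigcap_(i in [set: 'I_n])
      [set t | `|ratr (ck.1 0 i) - tnth t i| < ck.2.+1%:R^-1]); last first.
    by apply/seteqP; split=> [t h i _|t h i]; [exact: h|exact: (h i)].
  apply: fin_bigcap_measurable => // i _.
  rewrite (_ : [set t | _] = (fun t => tnth t i) @^-1`
      (ball (ratr (ck.1 0 i) : R) ck.2.+1%:R^-1))//.
  rewrite -[X in measurable X]setTI; apply: measurable_tnth => //.
  exact: measurable_ball.
have -> : @tvec R n @^-1` U =
    \bigcup_ck (if ck \in good then box ck else set0).
  apply/seteqP; split=> [t Ut|t [ck _]]; last first.
    by case: ifPn => // /set_mem; exact.
  have /nbhs_ballP[e /= e0 eU] : nbhs (tvec t) U.
    by move: oU; rewrite openE => /(_ _ Ut).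
  (* Half of [e], since two points of a cube of radius [r] are compared through its centre and so
     differ by less than [2 r] in each coordinate. *)
  have [k ke] : exists k, 0 + k.+1%:R^-1 < e / 2.
    by apply: ltr_add_invr; rewrite divr_gt0.
  rewrite add0r in ke.
  have k0 : 0 < k.+1%:R^-1 :> R by rewrite invr_gt0 ltr0n.
  set r : R := k.+1%:R^-1 in ke k0.
  have cP i : {q : rat | `|ratr q - tnth t i| < r}.
    apply: cid; have [|q] := @rat_in_itvoo R (tnth t i - r) (tnth t i + r).
      by lra.
    by rewrite in_itv/= => /andP[q1 q2]; exists q;
      rewrite ltr_norml; apply/andP; split; lra.
  exists (\row_i sval (cP i), k) => //.
  have tb : box (\row_i sval (cP i), k) t.
    by move=> i /=; rewrite mxE; exact: (svalP (cP i)).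
  rewrite ifT//; apply/mem_set => t' tb'; apply: eU.
  split => // j i; rewrite !ord1 !mxE /ball/=.
  have := tb i; have := tb' i; rewrite /= !mxE -/r => h1 h2.
  rewrite (_ : _ - _ = (ratr (sval (cP i)) - tnth t' i) -
     (ratr (sval (cP i)) - tnth t i)); last by ring.
  rewrite (le_lt_trans (ler_normB _ _))//; lra.
apply: countable_bigcupT_measurable; first exact: countableP.
by move=> ck; case: ifPn.
Qed.

Lemma measurable_continuous_tvec (R : realType) n (f : 'rV[R]_n -> R) :
  continuous f -> measurable_fun setT (f \o @tvec R n).
Proof.
move=> cf; apply: (measurability _ (RGenOInfty.measurableE R)) => //.
move=> /= _ [_ [x ->] <-]; rewrite setTI comp_preimage.
by apply: measurable_tvec_open; move/continuousP: cf; apply; exact: interval_open.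
Qed.

Lemma tvec_tuple_add (R : realType) n (x : 'rV[R]_n) (y : n.-tuple R) :
  x + tvec y = tvec (tuple_add [tuple x 0 i | i < n] y).
Proof. by apply/rowP => i; rewrite !mxE !tnth_mktuple. Qed.

Lemma measurable_continuous_shift (R : realType) n (f : 'rV[R]_n -> R)
    (x : 'rV[R]_n) :
  continuous f -> measurable_fun setT (fun y : n.-tuple R => f (x + tvec y)).
Proof.
move=> cf; under eq_fun do rewrite tvec_tuple_add.
by apply: (measurableT_comp (measurable_continuous_tvec cf));
  exact: measurable_tuple_add.
Qed.

(** * Euclidean and spectral norms *)

Lemma CauchySchwarz_sum (R : realType) (I : finType) (a b : I -> R) :
  \sum_i a i * b i <= Num.sqrt (\sum_i a i ^+ 2) * Num.sqrt (\sum_i b i ^+ 2).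
Proof.
have sq0 (c : I -> R) : 0 <= \sum_i c i ^+ 2.
  by apply: sumr_ge0 => i _; exact: sqr_ge0.
rewrite -sqrtrM// (le_trans (ler_norm _))// -sqrtr_sqr.
rewrite ler_sqrt; last exact: mulr_ge0.
rewrite -subr_ge0.
(* Lagrange's identity, which exhibits the difference as half a sum of squares. *)
have -> : (\sum_i a i ^+ 2) * (\sum_i b i ^+ 2) - (\sum_i a i * b i) ^+ 2 =
    2^-1 * \sum_i \sum_j (a i * b j - a j * b i) ^+ 2.
  have E1 : \sum_i \sum_j (a i ^+ 2 * b j ^+ 2) =
      (\sum_i a i ^+ 2) * (\sum_i b i ^+ 2).
    by rewrite mulr_suml; apply: eq_bigr => i _; rewrite mulr_sumr.
  have E2 : \sum_i \sum_j (a i * b i) * (a j * b j) = (\sum_i a i * b i) ^+ 2.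
    by rewrite expr2 mulr_suml; apply: eq_bigr => i _; rewrite mulr_sumr.
  have -> : \sum_i \sum_j (a i * b j - a j * b i) ^+ 2 =
      \sum_i \sum_j (a i ^+ 2 * b j ^+ 2) + \sum_j \sum_i (a i ^+ 2 * b j ^+ 2)
      - 2 * \sum_i \sum_j (a i * b i) * (a j * b j).
    rewrite mulr_sumr -!sumrN -!big_split/=; apply: eq_bigr => i _.
    rewrite mulr_sumr -!sumrN -!big_split/=; apply: eq_bigr => j _; ring.
  by rewrite [X in _ + X - _]exchange_big/= E1 E2; lra.
rewrite mulr_ge0 ?invr_ge0//; apply: sumr_ge0 => i _.
by apply: sumr_ge0 => j _; exact: sqr_ge0.
Qed.

Lemma l2norm_ge0 (R : realType) n (v : 'cV[R]_n) : 0 <= l2norm v.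
Proof. exact: sqrtr_ge0. Qed.

Lemma sqr_l2norm (R : realType) n (v : 'cV[R]_n) :
  l2norm v ^+ 2 = \sum_i v i 0 ^+ 2.
Proof. by rewrite sqr_sqrtr// sumr_ge0// => i _; exact: sqr_ge0. Qed.

Lemma normr_le_l2norm (R : realType) n (v : 'cV[R]_n) i : `|v i 0| <= l2norm v.
Proof.
rewrite -sqrtr_sqr ler_sqrt; last by apply: sumr_ge0 => j _; exact: sqr_ge0.
by rewrite (bigD1 i)//= lerDl; apply: sumr_ge0 => j _; exact: sqr_ge0.
Qed.

Lemma l2norm_delta (R : realType) n (i : 'I_n) :
  l2norm (delta_mx i 0 : 'cV[R]_n) = 1.
Proof.
rewrite /l2norm (bigD1 i)//= big1 ?addr0 ?mxE ?eqxx/= ?expr1n ?sqrtr1//.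
by move=> j ji; rewrite mxE (negbTE ji)/= expr0n.
Qed.

(** Cauchy-Schwarz on each row bounds the set by the Frobenius norm. This makes the [sup] in
    [spec_norm] a true upper bound instead of a default value. *)
Lemma has_ubound_spec_norm (R : realType) n (M : 'M[R]_n) :
  has_ubound [set l2norm (M *m u) | u in [set u : 'cV[R]_n | l2norm u = 1]].
Proof.
exists (Num.sqrt (\sum_i \sum_j M i j ^+ 2)) => _ [u /= u1 <-].
rewrite ler_sqrt; last by do 2 (apply: sumr_ge0 => ? _); exact: sqr_ge0.
apply: ler_sum => i _; rewrite mxE -ler_sqrt; last first.
  by apply: sumr_ge0 => ? _; exact: sqr_ge0.
rewrite sqrtr_sqr ler_norml; apply/andP; split.
  rewrite lerNl -sumrN (eq_bigr (fun j => - M i j * u j 0)); last first.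
    by move=> j _; rewrite mulNr.
  apply: le_trans (CauchySchwarz_sum _ _) _.
  rewrite -/(l2norm u) u1 mulr1.
  by rewrite (eq_bigr (fun j => M i j ^+ 2)) // => j _; rewrite sqrrN.
apply: le_trans (CauchySchwarz_sum _ _) _.
by rewrite -/(l2norm u) u1 mulr1.
Qed.

Lemma l2norm_le_spec_norm (R : realType) n (M : 'M[R]_n) (u : 'cV[R]_n) :
  l2norm u = 1 -> l2norm (M *m u) <= spec_norm M.
Proof. by move=> u1; apply: (ub_le_sup (has_ubound_spec_norm M)); exists u. Qed.

(** An entry is a coordinate of the image of a basis vector. This bounds the entries of the Hessian,
    which yields their integrability. *)
Lemma normr_le_spec_norm (R : realType) n (M : 'M[R]_n) i j :
  `|M i j| <= spec_norm M.
Proof.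
apply: (@le_trans _ _ (l2norm (M *m delta_mx j 0))); last first.
  by apply: l2norm_le_spec_norm; exact: l2norm_delta.
rewrite (_ : M i j = (M *m (delta_mx j 0 : 'cV_n)) i 0).
  exact: normr_le_l2norm.
by rewrite -colE mxE.
Qed.

(** Positivity of [n] supplies a unit vector, so the [sup] is over a nonempty set; for [n = 0] the
    premise is vacuous and a negative [a] would be a counterexample. *)
Lemma spec_norm_le (R : realType) n (M : 'M[R]_n) (a : R) : (0 < n)%N ->
  (forall u, l2norm u = 1 -> l2norm (M *m u) <= a) -> spec_norm M <= a.
Proof.
move=> n0 Ma; apply: ge_sup; last by move=> _ [u /= u1 <-]; exact: Ma.
exists (l2norm (M *m delta_mx (Ordinal n0) 0)), (delta_mx (Ordinal n0) 0) => //=.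
exact: l2norm_delta.
Qed.

(* No vector of R^0 is a unit vector, so [spec_norm] is here the junk value
   [sup set0]; hence the hypothesis [0 < s r] of the theorem excludes p = 0. *)
Lemma spec_norm0 (R : realType) (M : 'M[R]_0) : spec_norm M = 0.
Proof.
rewrite /spec_norm (_ : [set _ | _ in _] = set0) ?sup0//.
apply/seteqP; split=> // _ [u /= u1 _]; move: u1.
by rewrite /l2norm big_ord0 sqrtr0 => /eqP; rewrite eq_sym oner_eq0.
Qed.

(** * Openness of strict superlevel sets of the spectral norm *)

Lemma continuous_sum (R : realType) (T : topologicalType) (I : finType)
    (f : I -> T -> R) :
  (forall i, continuous (f i)) -> continuous (fun x => \sum_i f i x).
Proof.
move=> cf x; apply: cvg_big => [|i _]; first exact: add_continuous.
exact: cf.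
Qed.

(** Lower semicontinuity of a supremum of continuous functions: the set is the union, over unit
    vectors [u], of the open sets where the norm of [H x *m u] exceeds [a]. *)
Lemma open_spec_norm_gt (R : realType) n (H : 'rV[R]_n -> 'M[R]_n) (a : R) :
  (0 < n)%N -> (forall i j, continuous (fun x => H x i j)) ->
  open [set x | a < spec_norm (H x)].
Proof.
move=> n0 cH.
have -> : [set x | a < spec_norm (H x)] =
    \bigcup_(u in [set u | l2norm u = 1]) [set x | a < l2norm (H x *m u)].
  apply/seteqP; split=> [x /= ax|x [u /= u1 au]]; last first.
    exact: lt_le_trans au (l2norm_le_spec_norm _ u1).
  apply: contrapT => nau; move: ax; apply/negP; rewrite -leNgt.
  apply: spec_norm_le => // u u1; rewrite leNgt; apply/negP => au.
  by apply: nau; exists u.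
apply: bigcup_open => u _.
have cMu i : continuous (fun x => (H x *m u) i 0).
  under eq_fun do rewrite mxE.
  apply: continuous_sum => j x.
  by apply: continuousM; [exact: cH|exact: cst_continuous].
have cf : continuous (fun x => l2norm (H x *m u)).
  move=> x; apply: (@continuous_comp _ _ _
    (fun x => \sum_(i < n) (H x *m u) i 0 ^+ 2)).
    apply: continuous_sum => i {}x.
    by apply: (@continuous_comp _ _ _ (fun x => (H x *m u) i 0)
      (fun y => y ^+ 2));
      [exact: cMu|exact: exprn_continuous].
  exact: sqrt_continuous.
by move/continuousP: cf => /(_ _ (@open_gt _ a)).
Qed.

(** * Spectral norm of an averaged matrix *)

Lemma Rintegral_sum (R : realType) d (T : measurableType d)
    (mu : {measure set T -> \bar R}) (I : finType) (F : I -> T -> R) :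
  (forall i, mu.-integrable setT (EFin \o F i)) ->
  Rintegral mu setT (fun t => \sum_i F i t) = \sum_i Rintegral mu setT (F i).
Proof.
move=> iF; apply: EFin_inj; rewrite /Rintegral -sumEFin.
rewrite [RHS](eq_bigr (fun i => \int[mu]_t (F i t)%:E)%E); last first.
  by move=> i _; rewrite fineK//; exact: integrable_fin_num (iF i).
rewrite -(integral_sum measurableT)// fineK.
  by apply: eq_integral => t _; rewrite sumEFin.
apply: integrable_fin_num => //.
apply: (eq_integrable measurableT
    (fun t => \sum_i (F i t)%:E)%E).
  by move=> t _; rewrite sumEFin.
by apply: integrable_sum => // i _; exact: iF.
Qed.

(* With w := (E M) u, integrating w^T M u <= |w| |M u| gives
   |w|^2 <= |w| E g. *)
Lemma spec_norm_Rintegral_le (R : realType) d (T : measurableType d)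
    (mu : {measure set T -> \bar R}) n (M : T -> 'M[R]_n) (g : T -> R) :
  (0 < n)%N ->
  (forall i j, mu.-integrable setT (fun t => (M t i j)%:E)) ->
  mu.-integrable setT (EFin \o g) ->
  (forall t, spec_norm (M t) <= g t) ->
  spec_norm (\matrix_(i, j) Rintegral mu setT (fun t => M t i j)) <=
  Rintegral mu setT g.
Proof.
move=> n0 iM ig Mg; apply: spec_norm_le => // u u1.
set w := _ *m u.
have wiE i : w i 0 = \sum_j Rintegral mu setT (fun t => M t i j) * u j 0.
  by rewrite mxE; apply: eq_bigr => j _; rewrite mxE.
(* The main argument cancels a factor [l2norm w], so a vanishing [w] is treated apart; there it is
   enough that [g] is nonnegative, being above a norm. *)
clearbody w; have [w0|w0] := leP (l2norm w) 0.
  apply: (le_trans w0); apply: Rintegral_ge0 => t _.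
  apply: le_trans (Mg t); apply: le_trans (l2norm_le_spec_norm (M t) u1).
  exact: l2norm_ge0.
have iwu i j : mu.-integrable setT (EFin \o (fun t => w i 0 * u j 0 * M t i j)).
  by apply: (integrableZl measurableT (w i 0 * u j 0) (iM i j)).
have iwMu i : mu.-integrable setT (EFin \o (fun t => w i 0 * (M t *m u) i 0)).
  apply: (eq_integrable measurableT
    (fun t => \sum_j (w i 0 * u j 0 * M t i j)%:E)%E).
    move=> t _; rewrite sumEFin /= [(M t *m u) i 0]mxE mulr_sumr; congr EFin.
    by apply: eq_bigr => j _; ring.
  by apply: integrable_sum => // j _; exact: iwu.
have wE : l2norm w ^+ 2 =
    Rintegral mu setT (fun t => \sum_i w i 0 * (M t *m u) i 0).
  rewrite sqr_l2norm Rintegral_sum//; apply: eq_bigr => i _.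
  rewrite expr2 {2}wiE mulr_sumr.
  transitivity (Rintegral mu setT (fun t => \sum_j w i 0 * u j 0 * M t i j)).
    rewrite Rintegral_sum//; apply: eq_bigr => j _.
    rewrite RintegralZl//; [ring|exact: iM].
  apply: eq_Rintegral => t _; rewrite [(M t *m u) i 0]mxE mulr_sumr.
  by apply: eq_bigr => j _; ring.
rewrite -(ler_pM2l w0) -expr2 wE -RintegralZl//.
apply: le_Rintegral => //.
- apply: (eq_integrable measurableT
    (fun t => \sum_i (w i 0 * (M t *m u) i 0)%:E)%E).
    by move=> t _; rewrite sumEFin.
  by apply: integrable_sum => // i _; exact: iwMu.
- exact: (integrableZl measurableT (l2norm w) ig).
- move=> t _; apply: (le_trans (CauchySchwarz_sum _ _)).
  apply: ler_wpM2l; first exact: l2norm_ge0.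
  by apply: le_trans (Mg t); exact: l2norm_le_spec_norm.
Qed.

(** * Smoothing the Hessian by a uniform perturbation *)

Lemma continuous_hessian (R : realType) p (f : 'rV[R]_p -> R) i j :
  C2 f -> continuous (fun x => hessian f x i j).
Proof. by move=> [_ [_ [_ cf]]]; under eq_fun do rewrite mxE; exact: cf. Qed.

Theorem theorem4p2 (R : realType) (p q : nat) (h : 'I_q -> 'rV[R]_p -> R)
  (hC2 : forall r, C2 (h r))
  (s : 'I_q -> \bar R)
  (hs : forall r, s r = ereal_sup [set (spec_norm (hessian (h r) x))%:E | x in [set: 'rV[R]_p]])
  (hs_pos : forall r, (0 < s r)%E) (hs_fin : forall r, (s r < +oo)%E)
  (c : R) (hc0 : 0 < c) (hc1 : c < 1)
  (S : 'I_q -> set 'rV[R]_p)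
  (hS : forall r, S r = [set x | ((c%:E * s r) < (spec_norm (hessian (h r) x))%:E)%E])
  (C : R) (hmu : (lebesgue_p (\bigcup_(r in [set: 'I_q]) S r) < C%:E)%E) :
  forall eps : R, 0 < eps ->
  exists P : probability (p.-tuple R) R,
    (forall r (x : 'rV[R]_p) (i j : 'I_p),
       P.-integrable [set: p.-tuple R]
         (fun eta => ((hessian (h r) (x + tvec eta)) i j)%:E)) /\
    forall r,
      (ereal_sup [set (spec_norm (\matrix_(i < p, j < p)
                    Rintegral P [set: p.-tuple R]
                      (fun eta => (hessian (h r) (x + tvec eta)) i j)))%:E
                 | x in [set: 'rV[R]_p]]
       < (c + eps)%:E * s r)%E.
Proof.
move=> eps eps0.
set U := \bigcup_(r in _) S r in hmu *.
have C0 : 0 < C.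
  rewrite -lte_fin; apply: le_lt_trans hmu.
  by apply: leb_iter_ge0 => t; rewrite lee_fin.
(* The second bound gives [K * C <= eps / 2]; the cap at 1 gives [K ^+ p <= K] for positive [p], so
   [K ^+ p * C <= eps / 2] as well. *)
pose K := Num.min 1 (eps / (2 * C)).
have K0 : 0 < K by rewrite lt_min ltr01 divr_gt0// mulr_gt0.
have K1 : K <= 1 by rewrite ge_min lexx.
have KC : K * C <= eps / 2.
  rewrite (le_trans (ler_wpM2r (ltW C0) (_ : K <= eps / (2 * C))))//.
    by rewrite ge_min lexx orbT.
  by rewrite invfM mulrA mulfVK// gt_eqF.
(* Side length of the cube, so that the density in each coordinate is [K]. *)
have l0 : 0 < K^-1 by rewrite invr_gt0.
pose P := tuple_prob (uniform_prob l0) p.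
have QK : translates_le (uniform_prob l0) K.
  by move=> a A mA; rewrite -[in leRHS](invrK K); exact: uniform_prob_shift_le.
have sP r : exists2 sr : R, s r = sr%:E & 0 < sr.
  move: (hs_pos r) (hs_fin r); case: (s r) => [sr||]//.
  by rewrite lte_fin => sr0 _; exists sr.
have Hle r sr x : s r = sr%:E -> spec_norm (hessian (h r) x) <= sr.
  by move=> sE; rewrite -lee_fin -sE hs; apply: ereal_sup_ubound; exists x.
(* An index [r] is required: [p] is positive only because [s r] is, and for [q = 0] the dimension
   may be 0. *)
have p0 (r : 'I_q) : (0 < p)%N.
  rewrite lt0n; apply/eqP => p0; have [sr sE sr0] := sP r.
  suff : (s r <= 0)%E by rewrite sE lee_fin leNgt sr0.
  rewrite hs; apply: ge_ereal_sup => _ [x _ <-]; rewrite lee_fin.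
  by move: (hessian (h r) x); rewrite p0 => M; rewrite spec_norm0.
have cH r i j : continuous (fun x => hessian (h r) x i j).
  exact: continuous_hessian.
(* A continuous entry bounded by [s r] is integrable for a finite measure, so the entrywise
   expectations are genuine. *)
have iH r x i j : P.-integrable setT
    (fun eta => (hessian (h r) (x + tvec eta) i j)%:E).
  apply: measurable_bounded_integrable => //.
  - by rewrite -ge0_fin_numE// fin_num_measure.
  - exact: (measurable_continuous_shift x (@cH r i j)).
  - have [sr sE _] := sP r; exists sr; split; first exact: num_real.
    move=> y sy eta _; apply: le_trans (ltW sy).
    exact: le_trans (normr_le_spec_norm _ _ _) (Hle _ _ _ sE).
exists P; split; first exact: iH.
move=> r; have [sr sE sr0] := sP r.
have oU : open U.
  apply: bigcup_open => r' _; have [sr' sE' _] := sP r'.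
  rewrite hS sE'; under eq_fun do rewrite -EFinM lte_fin.
  by apply: open_spec_norm_gt; [exact: p0 r'|exact: cH].
have mU : measurable (@tvec R p @^-1` U) by exact: measurable_tvec_open.
pose f : p.-tuple R -> R := \1_(@tvec R p @^-1` U).
have mf : measurable_fun setT f by exact: measurable_indic.
(* Indicator of the event that [x + eta] lies in [U], written with [tuple_add] to fit
   [tuple_prob_shift_le]. *)
pose fx (x : 'rV[R]_p) (eta : p.-tuple R) : R :=
  f (tuple_add [tuple x 0 i | i < p] eta).
have mfx x : measurable_fun setT (fx x).
  by apply: (measurableT_comp mf); exact: measurable_tuple_add.
have f01 t : 0 <= f t <= 1.
  by rewrite /f indicE; case: (_ \in _); rewrite /= lexx ler01.
have ifx x : P.-integrable setT (EFin \o fx x).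
  apply: measurable_bounded_integrable => //.
  - by rewrite -ge0_fin_numE// fin_num_measure.
  - exists 1; split; first exact: num_real.
    move=> y y1 eta _; apply: le_trans (ltW y1); rewrite /fx.
    have /andP[f0 f1] := f01 (tuple_add [tuple x 0 i | i < p] eta).
    by rewrite ger0_norm.
have fxle x : Rintegral P setT (fx x) <= eps / 2.
  rewrite -lee_fin fineK; last exact: integrable_fin_num (ifx x).
  have mEf : measurable_fun setT (EFin \o f) by exact/measurable_EFinP.
  have Ef0 t : (0 <= (EFin \o f) t)%E by rewrite lee_fin; have /andP[] := f01 t.
  (* The resulting [leb_iter] of the indicator is [lebesgue_p U] by definition, hence below [C]. *)
  apply: le_trans (tuple_prob_shift_le _ (ltW K0) QK mEf Ef0) _.
  apply: (@le_trans _ _ ((K ^+ p)%:E * C%:E)%E).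
    by apply: lee_wpmul2l; [rewrite lee_fin exprn_ge0// ltW|exact: ltW].
  rewrite -EFinM lee_fin; apply: le_trans KC; apply: ler_wpM2r; first exact: ltW.
  by rewrite -[leRHS]expr1; apply: ler_wiXn2l => //; [exact: ltW|exact: p0 r].
have Hg x eta :
    spec_norm (hessian (h r) (x + tvec eta)) <= c * sr + sr * fx x eta.
  rewrite /fx /f indicE tvec_tuple_add; set y := tuple_add _ _.
  have [yU|yU] := boolP (y \in _) => /=.
    by rewrite mulr1 (le_trans (Hle _ _ _ sE))// lerDr mulr_ge0// ltW.
  (* Off [U], a norm above [c * sr] would put the point in [S r], hence in [U]. *)
  rewrite mulr0 addr0 leNgt; apply/negP => cs; move/negP: yU; apply.
  by apply/mem_set; exists r => //; rewrite hS /= sE -EFinM lte_fin.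
rewrite sE -EFinM.
(* A supremum preserves only non-strict bounds; the gap between [eps / 2] and [eps] restores
   strictness. *)
apply: (@le_lt_trans _ _ (c * sr + sr * (eps / 2))%:E); last first.
  by rewrite lte_fin mulrDl ltrD2l [ltRHS]mulrC ltr_pM2l//
    ltr_pdivrMr// ltr_pMr// ltr1n.
apply: ge_ereal_sup => _ [x _ <-]; rewrite lee_fin.
have icst : P.-integrable setT (EFin \o cst (c * sr)).
  exact: finite_measure_integrable_cst.
have isfx : P.-integrable setT (EFin \o (fun eta => sr * fx x eta)).
  exact: (integrableZl measurableT sr (ifx x)).
apply: le_trans (spec_norm_Rintegral_le (p0 r) (iH r x) _ (Hg x)) _.
  exact: (integrableD measurableT icst isfx).
rewrite RintegralD// Rintegral_cst// RintegralZl//.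
rewrite (_ : fine (P setT) = 1) ?mulr1; last first.
  by rewrite [P setT]probability_setT.
rewrite lerD2l; apply: ler_wpM2l; [exact: ltW|exact: fxle].
Qed.
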